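(* Let $\Sigma$ be a finite set of size $k>3$ and let $n$ be a positive integer. Let $|Q(n,k)|$ be the number of $n$-quasigroups $\Sigma^n\to\Sigma$. Then: (a) if $k$ is even, $|Q(n,k)|\ge 2^{(k/2)^n}$; (b) if $k$ is divisible by $3$, $|Q(n,k)|\ge 2^{n(k/3)^n}$; (c) if $k=5$, $|Q(n,k)|\ge 2^{3^{n/3-c}}$, where $c<0.072$ is a constant depending only on $n\bmod 3$; (d) in all other cases (i.e., $k$ odd, not divisible by $3$, and $k\ne 5$), $|Q(n,k)|\ge 2^{1.5\lfloor k/3\rfloor^n}$.
   Context: For a nonempty set $\Sigma$ and a positive integer $n$, an $n$-ary operation $f:\Sigma^n\to\Sigma$ is an $n$-quasigroup if in the equality $z_0=f(z_1,\ldots,z_n)$ knowledge of any $n$ of the elements $z_0,\ldots,z_n$ uniquely specifies the remaining one. Distinct operations are counted as distinct. *)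

(* Defs.v *)
From HB Require Import structures.
From mathcomp Require Import all_boot all_order all_algebra.
From mathcomp Require Import all_classical all_reals all_analysis.

Set Implicit Arguments.
Unset Strict Implicit.
Unset Printing Implicit Defensive.

(* The word z = (z_0, z_1, ..., z_n) satisfies z_0 = f(z_1, ..., z_n). *)
Definition in_graph (Sigma : Type) (n : nat)
    (f : {ffun 'I_n -> Sigma} -> Sigma) (z : {ffun 'I_n.+1 -> Sigma}) : Prop :=
  z ord0 = f [ffun j : 'I_n => z (lift ord0 j)].

(* The n known elements are the z j with j != i; the entry z i is irrelevant,
   and w is the completion of the known elements to a solution. *)
Definition nquasigroup (Sigma : Type) (n : nat)
    (f : {ffun 'I_n -> Sigma} -> Sigma) : Prop :=
  forall (i : 'I_n.+1) (z : {ffun 'I_n.+1 -> Sigma}),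
    exists! w : {ffun 'I_n.+1 -> Sigma},
      (forall j : 'I_n.+1, j != i -> w j = z j) /\ in_graph f w.

Definition nquasigroups (n : nat) (Sigma : finType) :
    {set {ffun {ffun 'I_n -> Sigma} -> Sigma}} :=
  [set f : {ffun {ffun 'I_n -> Sigma} -> Sigma} | `[< nquasigroup f >]].

(* Main.v *)
(* Cases (a) and (b): over Z_m x B with |B| = 2 or 3, the B-component may be
   given, for each of the m^n values of the Z_m-components of the arguments, by
   an independently chosen n-quasigroup of order |B|.

   Cases (c) and (d): let rho be an involution of Sigma.  If a set of arguments
   of f contains, with every point x, the points y collinear with x such that
   f y = rho (f x), then replacing f by rho \o f on it gives a quasigroup again,
   so N disjoint such sets give 2^N quasigroups.  The sets are multiplied along
   compositions with a suitable Latin square g.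
   - (d): k = 2s + 1 and rho has s transpositions.  Each argument appended by
     F (x, z) = g (f x) z multiplies the number of sets by l >= k / 3: for k = 7,
     g is the Steiner quasigroup of the Fano plane (l = 2); otherwise g is the
     prolongation of a twisted Z_s x Z_2 along a transversal (l = s - 2).
   - (c): rho is a transposition whose support is a subquasigroup of g.  Then N
     sets for f give N + 1 sets for g (f x) z, the new one being the rest of the
     preimage of the support; and composing f and h by g multiplies their numbers
     of sets.  Blocks of three arguments thus contribute a factor 3, blocks of
     two a factor 2. *)
Require Import Defs.
From HB Require Import structures.
From mathcomp Require Import all_boot all_order all_algebra.
From mathcomp Require Import all_classical all_reals all_analysis.
From mathcomp Require Import zify ring lra.

Set Implicit Arguments.
Unset Strict Implicit.
Unset Printing Implicit Defensive.

Import Order.TTheory GRing.Theory Num.Theory.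
Local Open Scope ring_scope.

(** * Latin functions and their relation to $n$-quasigroups *)

(** Points are plain functions on an arbitrary index type, so that compositions can take their
    arguments from a sum [J1 + J2]. *)
Definition collinear (J S : Type) (j : J) (x y : J -> S) :=
  forall i, i <> j -> x i = y i.

Definition latin (J S : Type) (f : (J -> S) -> S) :=
  forall j x y, collinear j x y -> f x = f y -> x j = y j.

Definition latin2 (S : Type) (g : S -> S -> S) :=
  (forall u, injective (g u)) /\ (forall z, injective (g^~ z)).

Definition upd (J : eqType) (S : Type) (x : J -> S) (j : J) (s : S) : J -> S :=
  fun i => if i == j then s else x i.

Lemma collinearC (J S : Type) (j : J) (x y : J -> S) :
  collinear j x y -> collinear j y x.
Proof. by move=> xy i /xy. Qed.

Lemma latin_upd_inj (J : eqType) (S : Type) (f : (J -> S) -> S) x j :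
  latin f -> injective (fun s => f (upd x j s)).
Proof.
move=> lf s t /(lf j) /=; rewrite /upd eqxx; apply=> i /eqP ij.
by rewrite (negPf ij).
Qed.

Lemma inj_onto (S : finType) (h : S -> S) (v : S) :
  injective h -> exists s, h s = v.
Proof. by move=> /injF_bij [h' _ hK]; exists (h' v). Qed.

Lemma latin_onto (J S : finType) (f : (J -> S) -> S) (v : S) :
  (0 < #|J|)%N -> latin f -> exists x, f x = v.
Proof.
move=> /card_gt0P[j _] lf.
have [s <-] := inj_onto v (@latin_upd_inj J S f (fun=> v) j lf).
by exists (upd (fun=> v) j s).
Qed.

(** Only entry [i] of the completion is free. For [i = ord0] it is the value of [f]; otherwise it is
    found because an injection of a finite set into itself is onto. *)
Lemma inj_nquasigroup (S : finType) (n : nat) (f : {ffun 'I_n -> S} -> S) :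
  (forall x j, injective (fun s => f [ffun i => if i == j then s else x i])) ->
  nquasigroup f.
Proof.
move=> injf i z.
pose W s : {ffun 'I_n.+1 -> S} := [ffun j => if j == i then s else z j].
suff [s [gs us]] : exists! s, in_graph f (W s).
  exists (W s); split=> [|w [wz gw]].
    by split=> // j ji; rewrite ffunE (negPf ji).
  have wE : w = W (w i).
    apply/ffunP => j; rewrite ffunE; case: eqP => [->//|/eqP ji].
    exact: wz.
  by rewrite wE in gw *; rewrite (us _ gw).
rewrite /in_graph; case: (unliftP ord0 i) => [j|] ->{i} in W *.
- have [s sE] := inj_onto (z ord0) (injf [ffun l => z (lift ord0 l)] j).
  have WE t : [ffun l => W t (lift ord0 l)] =
      [ffun l => if l == j then t else [ffun l => z (lift ord0 l)] l].
    apply/ffunP => l; rewrite !ffunE (inj_eq lift_inj).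
    by case: eqP => // _; rewrite ffunE.
  exists s; split=> [|t]; rewrite !WE ffunE (negPf (neq_lift ord0 j)) //.
  by rewrite -sE => /injf.
- have WE t : [ffun l => W t (lift ord0 l)] = [ffun l => z (lift ord0 l)].
    by apply/ffunP => l; rewrite !ffunE eq_sym (negPf (neq_lift ord0 l)).
  exists (f [ffun l => z (lift ord0 l)]).
  by split=> [|t]; rewrite WE ffunE eqxx.
Qed.

Lemma card_eq_bij (S T : finType) :
  #|S| = #|T| -> exists (h : S -> T) (h' : T -> S), cancel h h' /\ cancel h' h.
Proof.
move=> e; exists (fun s => enum_val (cast_ord e (enum_rank s))).
exists (fun t => enum_val (cast_ord (esym e) (enum_rank t))).
by split=> x; rewrite enum_valK ?cast_ordK ?cast_ordKV enum_rankK.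
Qed.

Lemma leq_card_nquasigroups (E J S Sigma : finType) (n : nat)
    (F : E -> (J -> S) -> S) :
  (forall e, latin (F e)) -> (forall e e', F e =1 F e' -> e = e') ->
  #|J| = n -> #|S| = #|Sigma| -> (#|E| <= #|nquasigroups n Sigma|)%N.
Proof.
move=> lF injF cJ /card_eq_bij[b [a [bK aK]]].
have /card_eq_bij[r [q [rK qK]]] : #|J| = #|'I_n| by rewrite card_ord.
pose G e : {ffun {ffun 'I_n -> Sigma} -> Sigma} :=
  [ffun x : {ffun 'I_n -> Sigma} => b (F e (fun j => a (x (r j))))].
have injG : injective G.
  move=> e e' GE; apply: injF => x.
  have /ffunP/(_ [ffun i => b (x (q i))]) := GE.
  rewrite !ffunE => /(can_inj bK).
  by under eq_fun do rewrite ffunE rK bK.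
rewrite -(card_imset predT injG).
apply/subset_leq_card/fintype.subsetP => _ /imsetP[e _ ->].
rewrite inE; apply/asboolP/inj_nquasigroup => x j s t.
rewrite !ffunE => /(can_inj bK) /(lF e (q j)).
rewrite !ffunE qK eqxx => H; apply: (can_inj aK); apply: H => i iq.
by rewrite !ffunE; case: eqP => // rij; case: iq; rewrite -rij rK.
Qed.

(** * Cases (a) and (b): wreath products *)

(** Equal values at collinear points force equal [A]-components, as [p] is Latin; hence the same
    [q e] acts on both [B]-components. *)
Lemma latin_wreath (A B E J : finType) (p : (J -> A) -> A)
    (q : E -> (J -> B) -> B) (e : {ffun {ffun J -> A} -> E}) :
  latin p -> (forall e, latin (q e)) ->
  latin (fun x : J -> A * B =>
    (p (fun j => (x j).1), q (e [ffun j => (x j).1]) (fun j => (x j).2))).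
Proof.
move=> lp lq j x y xy [px].
have xy1 i : (x i).1 = (y i).1.
  case: (eqVneq i j) => [->|/eqP/xy->//].
  by apply: (lp j (fun i => (x i).1) (fun i => (y i).1)) => // l /xy->.
have -> : [ffun j => (x j).1] = [ffun j => (y j).1].
  by apply/ffunP => i; rewrite !ffunE.
move=> qx; rewrite [x j]surjective_pairing [y j]surjective_pairing xy1.
congr pair.
by apply: (lq _ j (fun i => (x i).2) (fun i => (y i).2) _ qx) => // l /xy->.
Qed.

Lemma card_wreath (A B E J Sigma : finType) (n : nat) (p : (J -> A) -> A)
    (q : E -> (J -> B) -> B) :
  latin p -> (forall e, latin (q e)) ->
  (forall e e', q e =1 q e' -> e = e') ->
  #|J| = n -> #|Sigma| = (#|A| * #|B|)%N ->
  (#|E| ^ (#|A| ^ n) <= #|nquasigroups n Sigma|)%N.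
Proof.
move=> lp lq injq <- cS; rewrite -!card_ffun.
apply: (leq_card_nquasigroups (J := J) (S := (A * B)%type)
  (fun e => @latin_wreath A B E J p q e lp lq)); rewrite ?card_prod//.
move=> e e' ee'; apply/ffunP => a; apply: injq => x.
have [] := ee' (fun j => (a j, x j)).
have -> : [ffun j => a j] = a by apply/ffunP => j; rewrite ffunE.
by [].
Qed.

Lemma latin_signed_sum (J : finType) (V : zmodType) (c : V)
    (e : {ffun J -> bool}) :
  latin (fun x : J -> V => c + \sum_j if e j then - x j else x j).
Proof.
move=> j x y xy /addrI.
rewrite (bigD1 j)//= [RHS](bigD1 j)//=.
rewrite (eq_bigr (fun j => if e j then - y j else y j)); last first.
  by move=> i /eqP/xy ->.
by move/addIr; case: (e j) => // /oppr_inj.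
Qed.

Lemma latin_sum (J : finType) (V : zmodType) :
  latin (fun x : J -> V => \sum_j x j).
Proof.
move=> j x y xy sE.
have E z : \sum_i (if [ffun=> false] i then - z i else z i) = \sum_i z i.
  by apply: eq_bigr => i _; rewrite ffunE.
by apply: (@latin_signed_sum J V 0 [ffun=> false] j x y xy); rewrite !E sE.
Qed.

Lemma card_nquasigroups_even (Sigma : finType) (n m : nat) :
  (0 < m)%N -> #|Sigma| = (m * 2)%N ->
  (2 ^ (m ^ n) <= #|nquasigroups n Sigma|)%N.
Proof.
case: m => // m _ cS.
(* The two quasigroups of order 2 are the sum and its complement, indexed by the constant [c]. *)
have := @card_wreath 'I_m.+1 'I_2 'I_2 'I_n Sigma n _
  (fun c x => c + \sum_j if [ffun=> false] j then - x j else x j)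
  (@latin_sum 'I_n 'I_m.+1)
  (fun c => @latin_signed_sum 'I_n 'I_2 c [ffun=> false]).
rewrite !card_ord; apply=> // c c' /(_ (fun=> 0)) /addIr//.
Qed.

Lemma card_nquasigroups_mul3 (Sigma : finType) (n m : nat) :
  (0 < m)%N -> #|Sigma| = (m * 3)%N ->
  (2 ^ (n * m ^ n) <= #|nquasigroups n Sigma|)%N.
Proof.
case: m => // m _ cS.
have := @card_wreath 'I_m.+1 'I_3 {ffun 'I_n -> bool} 'I_n Sigma n _
  (fun e x => 0 + \sum_j if e j then - x j else x j)
  (@latin_sum 'I_n 'I_m.+1) (@latin_signed_sum 'I_n 'I_3 0).
rewrite card_ffun card_bool !card_ord -expnM; apply=> // e e' ee'.
apply/ffunP => j.
(* The value at a unit vector is 1 or -1, which differ modulo 3, so the [2 ^ n] sign patterns give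
   distinct operations. *)
have := ee' (fun i => if i == j then 1 else 0).
rewrite !add0r (bigD1 j)//= [RHS](bigD1 j)//= eqxx.
rewrite !big1 ?addr0; first by case: (e j) (e' j) => [] [].
all: by move=> i /negPf ->; rewrite oppr0 if_same.
Qed.

(** * Disjoint switchable sets and their behaviour under composition *)

(** [cl x] is the index of the set containing [x], or [None] outside all sets, so disjointness is
    built in. The last two clauses make different choices of switched sets give different
    operations. *)
Definition switching (J S I : Type) (rho : S -> S) (f : (J -> S) -> S)
    (cl : (J -> S) -> option I) : Prop :=
  [/\ latin f,
      forall j x y i, collinear j x y -> f y = rho (f x) ->
        cl x = Some i -> cl y = Some i,
      forall x i, cl x = Some i -> rho (f x) <> f x
    & forall i, exists x, cl x = Some i].

(** A new coincidence of values on a line needs one switched and one unswitched point; closure of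
    the sets puts both into the same set, a contradiction. *)
Lemma latin_switch (J S I : Type) (rho : S -> S) f (cl : (J -> S) -> option I)
    (T : I -> bool) :
  involutive rho -> switching rho f cl ->
  latin (fun x => if cl x is Some i then if T i then rho (f x) else f x
                  else f x).
Proof.
move=> rhoK [lf clP _ _] j x y xy.
have yx := collinearC xy.
case Ex: (cl x) => [i|]; case Ey: (cl y) => [i'|]; try by apply: lf.
- case: ifP => Ti; case: ifP => Ti'; try by apply: lf.
  + by move/(inv_inj rhoK); apply: lf.
  + move=> fy; have := clP j x y i xy (esym fy) Ex.
    by rewrite Ey => -[ii']; rewrite ii' Ti in Ti'.
  + move=> fx; have := clP j y x i' yx fx Ey.
    by rewrite Ex => -[ii']; rewrite ii' Ti' in Ti.
- case: ifP => Ti; last exact: lf.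
  by move=> fy; have := clP j x y i xy (esym fy) Ex; rewrite Ey.
- case: ifP => Ti; last exact: lf.
  by move=> fx; have := clP j y x i' yx fx Ey; rewrite Ex.
Qed.

Lemma card_switching (J S I Sigma : finType) (n : nat) (rho : S -> S) f
    (cl : (J -> S) -> option I) :
  involutive rho -> switching rho f cl -> #|J| = n -> #|S| = #|Sigma| ->
  (2 ^ #|I| <= #|nquasigroups n Sigma|)%N.
Proof.
move=> rhoK sw; rewrite -card_bool -card_ffun.
move=> cJ cS; pose F (T : {ffun I -> bool}) (x : J -> S) :=
  if cl x is Some i then if T i then rho (f x) else f x else f x.
have lF T : latin (F T) := @latin_switch J S I rho f cl T rhoK sw.
apply: (leq_card_nquasigroups lF) => //.
case: sw => _ _ moved onto T T' TT'; apply/ffunP => i.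
have [x xi] := onto i; have := TT' x; have := moved x i xi.
by rewrite /F xi; case: (T i) (T' i) => [] [] // ne /esym.
Qed.

Lemma latin_comp (J1 J2 S : Type) (g : S -> S -> S) (f : (J1 -> S) -> S)
    (h : (J2 -> S) -> S) :
  latin2 g -> latin f -> latin h ->
  latin (fun x : J1 + J2 -> S => g (f (x \o inl)) (h (x \o inr))).
Proof.
move=> [gl gr] lf lh [j|j] x y xy.
- have -> : x \o inr = y \o inr by apply/funext => i; exact: xy.
  move/gr; apply: (lf j (x \o inl) (y \o inl)) => i ij.
  by apply: xy => -[].
- have -> : x \o inl = y \o inl by apply/funext => i; exact: xy.
  move/gl; apply: (lh j (x \o inr) (y \o inr)) => i ij.
  by apply: xy => -[].
Qed.

(** On a line in the first block, cancelling in [g] turns a switch of the composite into a switch of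
    [f], so [cl] is kept, and [c] is invariant under [rho]. On a line in the second block [f] is
    constant and [c] itself is closed. *)
Lemma switching_comp (J1 J2 S I L : Type) (rho : S -> S) (g : S -> S -> S)
    (f : (J1 -> S) -> S) (h : (J2 -> S) -> S) (cl : (J1 -> S) -> option I)
    (c : S -> (J2 -> S) -> option L) :
  latin2 g -> latin h -> switching rho f cl ->
  (forall u y l, rho u <> u -> c u y = Some l ->
    [/\ g (rho u) (h y) = rho (g u (h y)), c (rho u) y = Some l
      & forall j y', collinear j y y' -> g u (h y') = rho (g u (h y)) ->
          c u y' = Some l]) ->
  (forall u l, rho u <> u -> exists y, c u y = Some l) ->
  switching rho (fun x : J1 + J2 -> S => g (f (x \o inl)) (h (x \o inr)))
    (fun x => if cl (x \o inl) is Some i then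
       if c (f (x \o inl)) (x \o inr) is Some l then Some (i, l) else None
       else None).
Proof.
move=> lg lh [lf clP moved onto] cP conto.
split; first exact: (latin_comp lg lf lh).
- case=> j x y il xy.
  + have <- : x \o inr = y \o inr by apply/funext => i; exact: xy.
    have xy1 : collinear j (x \o inl) (y \o inl).
      by move=> i ij; apply: xy => -[].
    case Ex: (cl (x \o inl)) => [i|//].
    case Ec: (c _ _) => [l|//] gE [<-].
    have [gr cr _] := cP _ _ _ (moved _ _ Ex) Ec.
    have fy : f (y \o inl) = rho (f (x \o inl)).
      by apply: (lg.2 (h (x \o inr))); rewrite gE gr.
    by rewrite fy cr (clP _ _ _ _ xy1 fy Ex).
  + have <- : x \o inl = y \o inl by apply/funext => i; exact: xy.
    have xy1 : collinear j (x \o inr) (y \o inr).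
      by move=> i ij; apply: xy => -[].
    case Ex: (cl (x \o inl)) => [i|//].
    case Ec: (c _ _) => [l|//] gE [<-].
    have [_ _ cl'] := cP _ _ _ (moved _ _ Ex) Ec.
    by rewrite (cl' _ _ xy1 gE).
- move=> x il; case Ex: (cl _) => [i|//]; case Ec: (c _ _) => [l|//] _.
  have [<- _ _ /(lg.2)] := cP _ _ _ (moved _ _ Ex) Ec.
  exact: moved Ex.
- move=> [i l]; have [x xi] := onto i.
  have [y yl] := conto _ l (moved _ _ xi).
  exists (fun k => match k with inl a => x a | inr b => y b end).
  rewrite (_ : _ \o inl = x)// (_ : _ \o inr = y)//.
  by rewrite xi yl.
Qed.

(* [switchable rho n N]: some [n]-ary quasigroup has [N] disjoint sets on each
   of which its values can be replaced by their images under [rho]. *)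
Definition switchable (S : Type) (rho : S -> S) (n N : nat) : Prop :=
  exists (J I : finType) (f : (J -> S) -> S) (cl : (J -> S) -> option I),
    [/\ #|J| = n, #|I| = N & switching rho f cl].

Lemma switchable_card (S Sigma : finType) (rho : S -> S) (n N : nat) :
  involutive rho -> switchable rho n N -> #|S| = #|Sigma| ->
  (2 ^ N <= #|nquasigroups n Sigma|)%N.
Proof.
by move=> rhoK [J [I [f [cl [cJ <- sw]]]]]; exact: (card_switching rhoK sw).
Qed.

Lemma latin_unary (S : Type) : latin (fun x : unit -> S => x tt).
Proof. by move=> [] x y _. Qed.

Lemma switchable1 (S : Type) (I : finType) (rho : S -> S) (d : S -> option I) :
  (forall s i, d s = Some i -> d (rho s) = Some i /\ rho s <> s) ->
  (forall i, exists s, d s = Some i) ->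
  switchable rho 1 #|I|.
Proof.
move=> dP onto; exists unit, I, (fun x => x tt), (fun x => d (x tt)).
split=> //; first exact: card_unit; split.
- exact: latin_unary.
- by move=> j x y i _ -> /dP[].
- by move=> x i /dP[].
- by move=> i; have [s si] := onto i; exists (fun=> s).
Qed.

Lemma switchableS (S : Type) (L : finType) (rho : S -> S) (g : S -> S -> S)
    (c : S -> S -> option L) (n N : nat) :
  latin2 g ->
  (forall u z l, c u z = Some l ->
    [/\ g (rho u) z = rho (g u z), g u (rho z) = rho (g u z),
        c (rho u) z = Some l & c u (rho z) = Some l]) ->
  (forall u l, rho u <> u -> exists z, c u z = Some l) ->
  switchable rho n N -> switchable rho n.+1 (N * #|L|).
Proof.
move=> lg cP onto [J [I [f [cl [<- <- sw]]]]].
exists (J + unit)%type, (I * L)%type; do 2 eexists; split.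
- by rewrite card_sum card_unit addn1.
- by rewrite card_prod.
refine (switching_comp (c := fun u (y : unit -> S) => c u (y tt)) lg
  (@latin_unary S) sw _ _) => [u y l _ ul|u l ru].
- have [gu gz cu cz] := cP _ _ _ ul; split=> // _ y' _.
  by rewrite -gz => /(lg.1) ->.
- by have [z zl] := onto u l ru; exists (fun=> z).
Qed.

(* The hypothesis says that the points moved by [rho] form a subquasigroup on
   which [rho] is a translation. *)
Lemma switchableM (S : Type) (rho : S -> S) (g : S -> S -> S) (m n M N : nat) :
  latin2 g ->
  (forall u z, rho u <> u -> rho z <> z ->
    g (rho u) z = rho (g u z) /\ g u (rho z) = rho (g u z)) ->
  switchable rho m M -> switchable rho n N -> switchable rho (m + n) (M * N).
Proof.
move=> lg gP [J1 [I1 [f1 [cl1 [<- <- sw1]]]]] [J2 [I2 [f2 [cl2 [<- <- sw2]]]]].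
exists (J1 + J2)%type, (I1 * I2)%type; do 2 eexists; split.
- by rewrite card_sum.
- by rewrite card_prod.
have [lf2 clP2 moved2 onto2] := sw2.
apply: (switching_comp (h := f2) (c := fun u y => cl2 y) lg _ sw1) => //.
move=> u y l ru yl; have [gu gz] := gP _ _ ru (moved2 _ _ yl).
split=> // j y' yy'; rewrite -gz => /(lg.1) fy'.
exact: clP2 yy' fy' yl.
Qed.

Lemma switchableD1 (S : finType) (rho : S -> S) (g : S -> S -> S) (n N : nat) :
  involutive rho -> latin2 g ->
  (forall u z, rho u <> u -> rho z <> z ->
    g (rho u) z = rho (g u z) /\ g u (rho z) = rho (g u z)) ->
  (exists s, rho s <> s) -> (exists s, rho s = s) ->
  (0 < n)%N -> switchable rho n N -> switchable rho n.+1 N.+1.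
Proof.
move=> rhoK lg gP [m rm] [s0 rs0] n0 [J [I [f [cl [cJ <- sw]]]]].
have [lf clP moved onto] := sw.
pose F (x : J + unit -> S) := g (f (x \o inl)) (x (inr tt)).
(* Both arguments of [g] lie in the support of [rho]. *)
pose inner (x : J + unit -> S) :=
  (rho (f (x \o inl)) != f (x \o inl)) && (rho (x (inr tt)) != x (inr tt)).
have inner_closed j x y : collinear j x y -> F y = rho (F x) -> inner x ->
    inner y.
  move=> xy Fy /andP[/eqP rf /eqP rx].
  have [gu gz] := gP _ _ rf rx.
  case: j xy => [j|[]] xy.
  - have yz : y (inr tt) = x (inr tt) by rewrite xy.
    have fy : f (y \o inl) = rho (f (x \o inl)).
      by apply: (lg.2 (x (inr tt))); rewrite gu -[RHS]Fy /F yz.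
    by apply/andP; rewrite fy yz rhoK; split; apply/eqP => //; exact/nesym.
  - have fy : y \o inl = x \o inl by apply/funext => i; rewrite /= xy.
    have yz : y (inr tt) = rho (x (inr tt)).
      by apply: (lg.1 (f (x \o inl))); rewrite gz -[RHS]Fy /F fy.
    by apply/andP; rewrite fy yz rhoK; split; apply/eqP => //; exact/nesym.
(* The label [Some None] marks the new set: values moved by [rho], reached from outside [inner]. *)
exists (J + unit)%type, (option I), F, (fun x =>
  if rho (F x) == F x then None
  else if inner x then omap Some (cl (x \o inl)) else Some None).
split; first by rewrite card_sum card_unit cJ addn1.
  by rewrite card_option.
split.
- exact: (latin_comp lg lf (@latin_unary S)).
- move=> j x y i xy Fy; rewrite Fy rhoK eq_sym.
  have Fx : F x = rho (F y) by rewrite Fy rhoK.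
  case: eqP => // rF; case: ifP => [ix|/negP nix]; last first.
    case: ifP => // iy; case: nix.
    exact: inner_closed (collinearC xy) Fx iy.
  rewrite (inner_closed _ _ _ xy Fy ix).
  move/andP: ix => [/eqP rf /eqP rx].
  have [gu gz] := gP _ _ rf rx.
  case E: (cl _) => [k|//] /= [<-].
  case: j xy => [j|[]] xy.
  + have fy : f (y \o inl) = rho (f (x \o inl)).
      by apply: (lg.2 (x (inr tt))); rewrite gu -[RHS]Fy /F xy.
    rewrite (clP j (x \o inl) (y \o inl) k _ fy E)//.
    by move=> l lj; apply: xy => -[].
  + have <- : x \o inl = y \o inl by apply/funext => l; exact: xy.
    by rewrite E.
- by move=> x i; case: eqP.
- case=> [i|].
  + have [x xi] := onto i; have rf := moved _ _ xi.
    exists (fun k => match k with inl a => x a | inr _ => m end).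
    rewrite /inner /F (_ : _ \o inl = x)// xi /=.
    have [gu _] := gP _ _ rf rm.
    have -> : rho (f x) != f x by apply/eqP.
    have -> : rho m != m by apply/eqP.
    by case: eqP => //; rewrite -gu => /(lg.2) /rf.
  (* The new set is nonempty: the last argument [s0] is fixed by [rho], so the point is not [inner],
     while the value is the moved [m]. *)
  + have [u gu] := inj_onto m (lg.2 s0).
    have [x fx] := latin_onto u (leq_trans n0 (eq_leq (esym cJ))) lf.
    exists (fun k => match k with inl a => x a | inr _ => s0 end).
    rewrite /inner /F (_ : _ \o inl = x)// fx /= gu rs0 eqxx andbF.
    by case: eqP.
Qed.

Lemma switchable_iter (S : Type) (L : finType) (rho : S -> S) (g : S -> S -> S)
    (c : S -> S -> option L) (n N : nat) :
  latin2 g ->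
  (forall u z l, c u z = Some l ->
    [/\ g (rho u) z = rho (g u z), g u (rho z) = rho (g u z),
        c (rho u) z = Some l & c u (rho z) = Some l]) ->
  (forall u l, rho u <> u -> exists z, c u z = Some l) ->
  switchable rho 1 N -> switchable rho n.+1 (N * #|L| ^ n).
Proof.
move=> lg cP onto swN; elim: n => [|n IHn]; first by rewrite muln1.
by rewrite expnSr mulnA; apply: switchableS lg cP onto IHn.
Qed.

(** * Case (d): quasigroups of odd order with a fixed point [None] *)

Definition flip (A : Type) (s : option (A * bool)) : option (A * bool) :=
  if s is Some (a, b) then Some (a, ~~ b) else None.

Lemma flipK (A : Type) : involutive (@flip A).
Proof. by case=> [[a []]|]. Qed.

Lemma switchable_flip (A : finType) : switchable (@flip A) 1 #|A|.
Proof.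
apply: (switchable1 (d := omap fst)) => [[[a b]|] i|i] //=.
  by move=> [->]; split=> // -[]; case: b.
by exists (Some (i, true)).
Qed.

Definition next (i : option bool) : option bool :=
  match i with
  | None => Some false
  | Some false => Some true
  | Some true => None
  end.

(* The Steiner quasigroup of the Fano plane: [x * x = x], and [x * y] is the
   third point of the line through [x] and [y]; the lines through [None] are
   [{None, Some (a, false), Some (a, true)}]. *)
Definition fano (u z : option (option bool * bool)) :=
  match u, z with
  | None, _ => flip z
  | _, None => flip u
  | Some (a, b), Some (a', b') =>
      if a == a' then if b == b' then Some (a, b) else None
      else Some (if a' == next a then next a' else next a, b (+) b')
  end.

(** For [u] and [z] on different lines through [None], the label tells which of the two other lines
    contains [z]; [flip] preserves these lines. *)
Definition fano_label (u z : option (option bool * bool)) : option bool :=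
  if u is Some (a, _) then if z is Some (a', _) then
    if a == a' then None else Some (a' == next a) else None else None.

Lemma latin2_fano : latin2 fano.
Proof.
split=> [u z z'|z u u'].
  by case: u z z' => [[[[]|] []]|] [[[[]|] []]|] [[[[]|] []]|].
by case: u z u' => [[[[]|] []]|] [[[[]|] []]|] [[[[]|] []]|].
Qed.

Lemma switchable_fano n : switchable (@flip (option bool)) n.+1 (3 * 2 ^ n).
Proof.
rewrite -[2%N]card_bool.
apply: (switchable_iter (c := fano_label) n latin2_fano).
- by move=> [[[[]|] []]|] [[[[]|] []]|] [].
- move=> [[a b]|] l // _.
  exists (Some (if l then next a else next (next a), true)).
  by case: a l => [[]|] [].
- by have := switchable_flip (option bool); rewrite card_option card_bool.
Qed.

(* Adds a row, a column and a symbol [None], along the transversal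
   [{(x, tau x)}]. *)
Definition prolongation (X : eqType) (g : X -> X -> X) (tau tau' : X -> X)
    (u z : option X) : option X :=
  match u, z with
  | Some x, Some y => if y == tau x then None else Some (g x y)
  | Some x, None => Some (g x (tau x))
  | None, Some y => Some (g (tau' y) y)
  | None, None => None
  end.

(** Each symbol displaced by [None] reappears once in the new column and once in the new row, since
    the transversal meets every row, column and symbol once. *)
Lemma latin2_prolongation (X : eqType) (g : X -> X -> X) (tau tau' : X -> X) :
  latin2 g -> cancel tau tau' -> cancel tau' tau ->
  injective (fun x => g x (tau x)) -> latin2 (prolongation g tau tau').
Proof.
move=> [gl gr] tauK tau'K tr.
have tr' y y' : g (tau' y) y = g (tau' y') y' -> y = y'.
  by rewrite -{2}[y]tau'K -{2}[y']tau'K => /tr /(can_inj tau'K).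
split=> [[x|]|[z|]].
- move=> [y|] [y'|] //=; do ?case: eqP => //; try by move=> -> ->.
  + by move=> _ _ [] /gl ->.
  + by move=> ne [] /gl.
  + by move=> ne [] /gl /esym.
- by move=> [y|] [y'|] //= [] /tr' ->.
- move=> [x|] [x'|] //=; do ?case: eqP => //.
  + by move=> -> /(can_inj tauK) ->.
  + by move=> _ _ [] /gr ->.
  + by move=> ne [] /gr xE; case: ne; rewrite xE tau'K.
  + by move=> ne [] /gr xE; case: ne; rewrite -xE tau'K.
- by move=> [x|] [x'|] //= [] /tr ->.
Qed.

Section TwistedProduct.
Variable r : nat.
Notation Z := 'I_r.+2.

Definition shift (b : bool) : Z := if b then 1 else 0.

(* The bit makes [(a, b) |-> (a + (a + shift b), carry a (a + shift b))] the
   division of [2a + b] by [r.+2], hence injective. *)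
Definition carry (a a' : Z) : bool := (r.+2 <= a.*2 + (a' != a))%N.

(** For odd [r.+2] the untwisted group has no transversal, its Sylow 2-subgroup being cyclic and
    nontrivial. *)
Definition twisted (x y : Z * bool) : Z * bool :=
  (x.1 + y.1, (x.2 (+) y.2) (+) carry x.1 y.1).

Definition tau (x : Z * bool) : Z * bool := (x.1 + shift x.2, x.2).
Definition tau' (x : Z * bool) : Z * bool := (x.1 - shift x.2, x.2).

Lemma latin2_twisted : latin2 twisted.
Proof.
split=> [[a b] [a1 b1] [a2 b2]|[a b] [a1 b1] [a2 b2]].
  move=> e; have /addrI a12 : a + a1 = a + a2 := congr1 fst e.
  by have := congr1 snd e; rewrite /= a12 => /addIb /addbI ->.
move=> e; have /addIr a12 : a1 + a = a2 + a := congr1 fst e.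
by have := congr1 snd e; rewrite /= a12 => /addIb /addIb ->.
Qed.

Lemma carryE (a : Z) (b : bool) : carry a (a + shift b) = (r.+2 <= a.*2 + b)%N.
Proof.
by rewrite /carry -subr_eq0 addrAC subrr add0r; case: b; rewrite /= ?oner_eq0.
Qed.

Lemma modn_carry (v s : nat) : (v < s.*2)%N -> v = (v %% s + (s <= v)%N * s)%N.
Proof.
move=> vs; case: (leqP s v) => sv; last by rewrite modn_small // addn0.
rewrite -{2}(subnK sv) modnDr modn_small ?mul1n ?subnK//.
by rewrite ltn_subLR // addnn.
Qed.

Lemma twisted_transversal : injective (fun x => twisted x (tau x)).
Proof.
have tE a b : twisted (a, b) (tau (a, b)) =
    (a + (a + shift b), (r.+2 <= a.*2 + b)%N).
  by rewrite /twisted /tau /= addbb carryE.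
have vE a (b : bool) : a + (a + shift b) = ((a.*2 + b) %% r.+2)%N :> nat.
  by rewrite /= modnDmr addnA addnn; case: b.
(* This bound makes the quotient by [r.+2] a single bit. *)
have vlt (a : Z) (b : bool) : (a.*2 + b < r.+2.*2)%N.
  by have := ltn_ord a; case: b; lia.
move=> [a b] [a' b']; rewrite !tE.
move=> /pair_equal_spec[/(congr1 (@nat_of_ord _))]; rewrite !vE => vv cc.
have e : (a.*2 + b = a'.*2 + b')%N.
  by rewrite (modn_carry (vlt a b)) (modn_carry (vlt a' b')) vv cc.
have bb : b = b' by case: b b' e {vv cc} => [] []; lia.
by rewrite -{}bb in e *; congr pair; apply: ord_inj; lia.
Qed.

(** Differences 0 and 1 are excluded because the transversal [tau] lives there; [r] labels
    remain. *)
Definition twisted_label (u z : option (Z * bool)) :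
    option {d : Z | d \notin [:: 0; 1]} :=
  if u is Some (a, _) then if z is Some (a', _) then insub (a' - a) else None
  else None.

Lemma switchable_twisted n : switchable (@flip Z) n.+1 (r.+2 * r ^ n).
Proof.
have tauK : cancel tau tau' by move=> [a b]; rewrite /tau /tau' /= addrK.
have tau'K : cancel tau' tau by move=> [a b]; rewrite /tau /tau' /= subrK.
have cardL : #|{: {d : Z | d \notin [:: 0; 1]}}| = r.
  rewrite card_sig; apply/eqP; rewrite -(eqn_add2l #|[:: 0; 1 : Z]|).
  by rewrite cardC card_ord (card_uniqP _).
have lg := latin2_prolongation latin2_twisted tauK tau'K twisted_transversal.
rewrite -[X in (_ * X ^ _)%N]cardL.
apply: (switchable_iter (c := twisted_label) n lg).
- move=> [[a b]|] [[a' b']|] l //= cl.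
  (* Off the transversal the prolongation agrees with [twisted], where flipping the bit of either
     argument flips the bit of the product. *)
  have nt x y : (a', x) == tau (a, y) = false.
    apply/negP => /eqP[] aE _; move: cl; rewrite aE addrAC subrr add0r insubF//.
    by case: y aE => _; rewrite !inE eqxx ?orbT.
  by rewrite !nt /twisted /= cl addNb addbN addNb; split.
- move=> [[a b]|] d // _; exists (Some (a + val d, true)) => /=.
  by rewrite addrAC subrr add0r valK.
- by have := switchable_flip Z; rewrite card_ord.
Qed.

End TwistedProduct.

(** * Case (c): order 5 *)

(* A quasigroup of order 5 with the subquasigroup [{inl false, inl true}]. *)
Definition five (u z : bool + option bool) : bool + option bool :=
  match u, z with
  | inl b, inl b' => inl (b (+) b')
  | inl b, inr i | inr i, inl b => inr (if b then next i else i)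
  | inr i, inr j => if i == j then inr (next (next i)) else inl (j == next i)
  end.

Definition neg_inl (s : bool + option bool) : bool + option bool :=
  if s is inl b then inl (~~ b) else s.

Lemma neg_inlK : involutive neg_inl.
Proof. by case=> [[]|]. Qed.

Lemma latin2_five : latin2 five.
Proof.
split=> [u z z'|z u u'].
  by case: u z z' => [[]|[[]|]] [[]|[[]|]] [[]|[[]|]].
by case: u z u' => [[]|[[]|]] [[]|[[]|]] [[]|[[]|]].
Qed.

Lemma five_neg_inl u z : neg_inl u <> u -> neg_inl z <> z ->
  five (neg_inl u) z = neg_inl (five u z) /\
  five u (neg_inl z) = neg_inl (five u z).
Proof. by case: u z => [b|i] [b'|j] //=; rewrite addNb addbN. Qed.

Lemma switchable5D1 n N : (0 < n)%N ->
  switchable neg_inl n N -> switchable neg_inl n.+1 N.+1.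
Proof.
apply: (switchableD1 neg_inlK latin2_five five_neg_inl).
  by exists (inl true).
by exists (inr None).
Qed.

Lemma switchable5_1 : switchable neg_inl 1 1.
Proof.
rewrite -[X in switchable _ _ X]card_unit.
apply: (switchable1 (d := fun s => if s is inl _ then Some tt else None)).
  by move=> [[]|].
by move=> []; exists (inl true).
Qed.

Lemma switchable5 t :
  [/\ switchable neg_inl (3 * t.+1) (3 ^ t.+1),
      switchable neg_inl (3 * t.+1).+1 (4 * 3 ^ t)
    & switchable neg_inl (3 * t).+2 (2 * 3 ^ t)].
Proof.
have s2 : switchable neg_inl 2 2 by apply: switchable5D1 switchable5_1.
have s3 : switchable neg_inl 3 3 by apply: switchable5D1 s2.
have sM m n M N := @switchableM _ neg_inl five m n M N latin2_five five_neg_inl.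
elim: t => [|t [s s' s'']]; split=> //.
(* Four arguments are split as 2 + 2, since the product for 3 + 1 is only 3. *)
- exact: (sM 2 2 2 2)%N.
- by rewrite expnS mulnS; apply: sM.
- by rewrite expnS mulnS -addnS mulnCA; apply: sM.
- by rewrite expnS mulnS -2!addnS mulnCA; apply: sM.
Qed.

(** * Real exponents for case (c) *)

Section LogBounds.
Variable R : realType.

Definition log32 : R := ln 2 / ln 3.

Lemma ln3_gt0 : 0 < ln 3 :> R.
Proof. by rewrite ln_gt0 // ltr1n. Qed.

Lemma powR3_log32 : 3 `^ log32 = 2.
Proof.
by rewrite /powR (negPf (lt0r_neq0 _)) ?divfK ?lnK ?lt0r_neq0 ?ln3_gt0 ?posrE.
Qed.

Lemma log32_le1 : log32 <= 1.
Proof.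
by rewrite ler_pdivrMr ?ln3_gt0 // mul1r ler_ln ?posrE // ler_nat.
Qed.

(* Of the lower bounds of [log32] that give [4 / 3 - 2 * log32 < 72 / 1000],
   41/65 has the smallest denominator; it means [3 ^ 41 < 2 ^ 65]. *)
Lemma log32_gt : 41 / 65 < log32.
Proof.
rewrite ltr_pdivlMr ?ln3_gt0 // mulrAC ltr_pdivrMr //.
suff : ln (3 ^+ 41) < ln (2 ^+ 65) :> R.
  by rewrite !lnXn // -[_ *+ 41]mulr_natr -[_ *+ 65]mulr_natr; lra.
rewrite ltr_ln ?posrE ?exprn_gt0 // -!natrX ltr_nat.
lia.
Qed.

Lemma powR3D (t : nat) (x : R) : 3 `^ (t%:R + x) = 3 ^+ t * 3 `^ x.
Proof. by rewrite powRD ?powR_mulrn // pnatr_eq0 implybT. Qed.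

(** Chosen so that [n / 3 - defect] is exactly the base-3 logarithm of the number of sets [3 ^ t],
    [4 * 3 ^ t] or [2 * 3 ^ t]; only [n = 1] escapes this. *)
Definition defect (i : nat) : R :=
  match i with 0 => 0 | 1 => 4 / 3 - 2 * log32 | _ => 2 / 3 - log32 end.

Lemma defect_lt i : defect i < 72 / 1000.
Proof. by have := log32_gt; case: i => [|[|i]] /=; lra. Qed.

Lemma powR_le_card (x : R) (N C : nat) :
  (2 ^ N <= C)%N -> x <= N%:R -> 2 `^ x <= C%:R.
Proof.
move=> NC xN; apply: le_trans (_ : (2 ^ N)%:R <= _); last by rewrite ler_nat.
by rewrite natrX -powR_mulrn //; apply: ler_powR => //; rewrite ler1n.
Qed.

Lemma powR_defect0 t : 3 `^ ((3 * t)%:R / 3 - defect 0) = (3 ^ t)%:R.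
Proof.
have -> : (3 * t)%:R / 3 - defect 0 = t%:R + 0 by rewrite natrM /=; field.
by rewrite powR3D powRr0 mulr1 natrX.
Qed.

Lemma powR_defect1 t :
  3 `^ ((3 * t.+1).+1%:R / 3 - defect 1) = (4 * 3 ^ t)%:R.
Proof.
have -> : (3 * t.+1).+1%:R / 3 - defect 1 = t%:R + (log32 + log32).
  by rewrite -addn1 natrD natrM -[t.+1]addn1 natrD /=; field.
rewrite powR3D powRD ?pnatr_eq0 ?implybT // powR3_log32 natrM natrX mulrC.
by rewrite -natrM.
Qed.

Lemma powR_defect2 t : 3 `^ ((3 * t).+2%:R / 3 - defect 2) = (2 * 3 ^ t)%:R.
Proof.
have -> : (3 * t).+2%:R / 3 - defect 2 = t%:R + log32.
  by rewrite -addn2 natrD natrM /=; field.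
by rewrite powR3D powR3_log32 natrM natrX mulrC.
Qed.

Lemma powR_defect1_le : 3 `^ (1 / 3 - defect 1) <= 2.
Proof.
rewrite -powR3_log32; apply: ler_powR; first by rewrite ler1n.
by rewrite /=; have := log32_le1; lra.
Qed.

End LogBounds.

(** * Assembly of the bounds *)

Lemma card_nquasigroups5 (R : realType) (Sigma : finType) (n : nat) :
  (0 < n)%N -> #|Sigma| = 5 ->
  2 `^ (3 `^ (n%:R / 3 - defect R (n %% 3)%N)) <= #|nquasigroups n Sigma|%:R :> R.
Proof.
move=> n0 c5.
have sc m N : switchable neg_inl m N -> (2 ^ N <= #|nquasigroups m Sigma|)%N.
  move=> /(switchable_card neg_inlK); apply.
  by rewrite c5 card_sum card_option card_bool.
have nE := divn_eq n 3; have := ltn_mod n 3.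
move: nE n0; case: (n %% 3)%N => [|[|[|//]]]; case: (n %/ 3)%N => [|t] -> // _ _;
  rewrite mulnC ?addn0 ?addn1 ?addn2.
- apply: (powR_le_card (sc _ _ _)); last by rewrite powR_defect0.
  by have [] := switchable5 t.
(* For [n = 1] the bound asks for 4/3 sets, more than the one set of [neg_inl]; [flip] on
   [option (bool * bool)] has two transpositions. *)
- have sw := switchable_flip bool; rewrite card_bool in sw.
  apply: (powR_le_card (switchable_card (@flipK _) sw _)).
    by rewrite card_option card_prod card_bool c5.
  exact: powR_defect1_le.
- apply: (powR_le_card (sc _ _ _)); last by rewrite powR_defect1.
  by have [] := switchable5 t.
- apply: (powR_le_card (sc _ _ _)); last by rewrite powR_defect2.
  by have [] := switchable5 0.
- apply: (powR_le_card (sc _ _ _)); last by rewrite powR_defect2.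
  by have [] := switchable5 t.+1.
Qed.

Lemma switchable_odd (k : nat) : odd k -> (6 < k)%N -> ~~ (3 %| k)%N ->
  exists A : finType, k = (#|A| * 2).+1 /\
    forall n, exists2 N, switchable (@flip A) n.+1 N &
      (3 * (k %/ 3) ^ n.+1 <= N * 2)%N.
Proof.
move=> ok k6 k3.
have [->|k7] := eqVneq k 7.
  exists (option bool); rewrite card_option card_bool; split=> // n.
  by exists (3 * 2 ^ n)%N; [exact: switchable_fano|rewrite expnSr mulnA].
have kE : k = (k %/ 2 * 2).+1 by lia.
have [r rE] : exists r, (k %/ 2)%N = r.+2 by exists (k %/ 2 - 2)%N; lia.
exists 'I_r.+2; rewrite card_ord; split=> [|n]; first by rewrite -rE.
exists (r.+2 * r ^ n)%N; first exact: switchable_twisted.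
(* As 3 does not divide [k], [3 * (k %/ 3)] is at most [k - 1 = 2 * r.+2]. The remaining
   [k %/ 3 <= r] holds as [k] is at least 11; it fails for 7. *)
rewrite expnS mulnA -[leqRHS]mulnAC leq_mul//; first by lia.
by case: n => // n; rewrite leq_exp2r //; lia.
Qed.

Lemma card_nquasigroups_odd (R : realType) (Sigma : finType) (n k : nat) :
  (0 < n)%N -> #|Sigma| = k -> odd k -> (6 < k)%N -> ~~ (3 %| k)%N ->
  2 `^ (3 / 2 * (k %/ 3)%:R ^+ n) <= #|nquasigroups n Sigma|%:R :> R.
Proof.
case: n => // n _ cS ok k6 k3.
have [A [kA /(_ n)[N sw le]]] := switchable_odd ok k6 k3.
apply: (powR_le_card (switchable_card (@flipK A) sw _)).
  by rewrite card_option card_prod card_bool cS.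
move: le; rewrite -(ler_nat R) !natrM -natrX; lra.
Qed.

Theorem theorem3 (R : realType) :
  exists c : nat -> R,
    (forall r : nat, c r < 72 / 1000) /\
    forall (Sigma : finType) (n k : nat),
      (0 < n)%N -> #|Sigma| = k -> (3 < k)%N ->
      [/\ ~~ odd k ->
            (2 ^ ((k %/ 2) ^ n) <= #|nquasigroups n Sigma|)%N,
          (3 %| k)%N ->
            (2 ^ (n * (k %/ 3) ^ n) <= #|nquasigroups n Sigma|)%N,
          k = 5%N ->
            2 `^ (3 `^ (n%:R / 3 - c (n %% 3)%N))
              <= #|nquasigroups n Sigma|%:R :> R
        & odd k -> ~~ (3 %| k)%N -> k <> 5%N ->
            2 `^ (3 / 2 * (k %/ 3)%:R ^+ n)
              <= #|nquasigroups n Sigma|%:R :> R].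
Proof.
exists (@defect R); split=> [|Sigma n k n0 cS k3]; first exact: defect_lt.
split=> [ek|tk|k5|ok tk k5].
- by apply: card_nquasigroups_even; lia.
- by apply: card_nquasigroups_mul3; lia.
- by apply: card_nquasigroups5 => //; rewrite cS.
- by apply: card_nquasigroups_odd => //; lia.
Qed.
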